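(* Let $[U,\mathcal K]\subseteq[\mathbb R^n,\mathcal K^\star]$, where $\mathcal K^\star$ is the collection of all convex subsets of $\mathbb R^n$. Consider any $P\in\mathcal K$ such that $P_I:=\operatorname{conv}(P)$ with respect to $\mathbb R^n$ is a full-dimensional polyhedron, and any relaxation $P'$ of $P$. Suppose the family of disjunctions used in branch-and-cut tree certificates includes the simple valid disjunctions $H,H^c$ for any halfspace $H$ in the larger Helly system $[\mathbb R^n,\mathcal K^\star]$. Then $$\text{facet complexity of }P\ \le\ \text{validity complexity of }P\ \le\ n\,(\text{facet complexity of }P+1).$$
   Context: $[U,\mathcal K]\subseteq[\mathbb R^n,\mathcal K^\star]$ means that $U\subseteq\mathbb R^n$ and $\mathcal K=\{C\cap U:C\subseteq\mathbb R^n\text{ convex}\}$. A relaxation of $K\in\mathcal K$ is a convex set $K'\subseteq\mathbb R^n$ with $K'\cap U=K$ (and $K$ is the restriction of $K'$). A halfspace in $[\mathbb R^n,\mathcal K^\star]$ is a convex set $H\subseteq\mathbb R^n$ whose complement $H^c=\mathbb R^n\setminus H$ is also convex. It is a valid halfspace for $K\in\mathcal K$ if $K\subseteq H\cap U$. A valid disjunction is a finite collection of convex sets $D_1,\dots,D_p\subseteq\mathbb R^n$ with $\bigcup_i(D_i\cap U)=U$. Here $P$ stands for a system $K_1,\dots,K_t\in\mathcal K$ with $P=K_1\cap\dots\cap K_t$, and $P'$ for a system of relaxations $K'_1,\dots,K'_t$ of these sets with $P'=K'_1\cap\dots\cap K'_t$. A certificate of infeasibility for a system of sets with empty intersection is a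 binary string that a fixed checking algorithm accepts in time polynomial in the lengths of the system and the string; every infeasible system has one and no feasible system does. Its size is its length. A branch-and-cut tree is a rooted tree in which each node has two labels. The first label is a list $\mathcal L$ of convex sets in $\mathbb R^n$. The second label of an internal node with list $\mathcal L$ is either (a) a valid disjunction $D_1,\dots,D_p$, in which case the node has $p$ children with first labels $\mathcal L\cup\{D_i\}$; or (b) a valid halfspace $G'$ for the intersection of $U$ with all sets in $\mathcal L$, in which case the node has two children: the right child has first label $\mathcal L\cup\{G'\}$, and the left child is a leaf, called a cutting plane certifier, whose second label is a certificate of infeasibility (possibly itself a branch-and-cut certificate) for the system consisting of the restrictions of the sets in $\mathcal L$ together with $U\setminus G'$. The second label of any other leaf may be empty or hold a certificate of infeasibility. The size of the tree is its total number of nodes plus the sum of the sizes of all infeasibility certificates provided at the nodes with valid halfspaces. One can restrict the families of valid disjunctions and of valid halfspaces that may be used; all complexities are relative to this choice, and a complexity is $+\infty$ if no tree of the required kind exists. Complexities are assumed finite for simplicity (in the infinite case the inequalities are regarded as trivial). For a valid halfspace $H'$ for $P$, a branch-and-cut tree proves $H'$ with respect to $K'_1,\dots,K'_t$ if its root has first label $\{K'_1,\dots,K'_t\}$ and for every leaf the intersection of the sets in the first label of the leaf is contained in $H'$. The validity complexity of $H'$ is the smallest size of a branch-and-cut tree proving $H'$. The validity complexity of $P$ is the maximum validity complexity over all valid halfspaces for $P$. The validity complexity of a facet of $\operatorname{conv}(P)$ is the minimum of the validity complexities of all halfspaces that define that facet. The facet complexity of $P$ (with respect to $P'$) is the maximum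 validity complexity of all facets of $\operatorname{conv}(P)$.
   Formalization: The formal theorem adds that a certificate of infeasibility for a system remains a certificate when a further set is inserted into the system (without this the upper bound can fail), and it takes n ≥ 1. *)

(* Defs.v *)
From mathcomp Require Import all_boot all_order all_algebra.
From mathcomp Require Import boolp classical_sets reals constructive_ereal ereal.
From mathcomp Require Import convex.

Set Implicit Arguments.
Unset Strict Implicit.
Unset Printing Implicit Defensive.

Import Order.TTheory GRing.Theory Num.Theory.

Local Open Scope classical_set_scope.
Local Open Scope ring_scope.

(* Points of R^n are column vectors 'cV[R]_n; a linear functional is a row
   vector a : 'rV[R]_n, with value (a *m x) 0 0 at x. *)

Section Geometry.
Context {R : realType} {n : nat}.
Local Notation V := 'cV[R]_n.
Implicit Types (A F H K P Q U : set V) (a : 'rV[R]_n) (b : R).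

(* The library states [convex_set] on the alias [convex_lmodType V] of V. *)
Definition convex A : Prop := @convex_set R V A.

Definition conv_hull A : set V := smallest convex A.

Definition halfspace H : Prop := convex H /\ convex (~` H).

Definition polyhedron Q : Prop :=
  exists (m : nat) (M : 'M[R]_(m, n)) (c : 'cV[R]_m),
    Q = [set x | forall i, (M *m x) i 0 <= c i 0].

Definition affinely_independent (k : nat) (x : 'I_k.+1 -> V) : Prop :=
  row_free (\matrix_(i < k) (x (lift ord0 i) - x ord0)^T).

(* The dimension of A is d when d + 1 is the largest number of affinely
   independent points of A; the empty set has no dimension here. *)
Definition has_dim A (d : nat) : Prop :=
  (exists x : 'I_d.+1 -> V, affinely_independent x /\ forall i, A (x i)) /\
  (forall (k : nat) (x : 'I_k.+1 -> V),
     affinely_independent x -> (forall i, A (x i)) -> (k <= d)%N).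

Definition full_dimensional A : Prop := has_dim A n.

Definition hyperplane a b : set V := [set x | (a *m x) 0 0 = b].
Definition lower_open a b : set V := [set x | (a *m x) 0 0 < b].
Definition lower_closed a b : set V := [set x | (a *m x) 0 0 <= b].

Definition face Q F : Prop :=
  exists a b, Q `<=` lower_closed a b /\ F = Q `&` hyperplane a b.

Definition facet Q F : Prop :=
  face Q F /\ exists d, has_dim Q d.+1 /\ has_dim F d.

Definition in_family U K : Prop := exists2 C, convex C & K = C `&` U.

Definition relaxation U K K' : Prop := convex K' /\ K' `&` U = K.

Definition valid_halfspace U H K : Prop := halfspace H /\ K `<=` H `&` U.

Definition valid_disjunction U (D : seq (set V)) : Prop :=
  (forall i, (i < size D)%N -> convex (nth set0 D i)) /\
  \big[setU/set0]_(A <- D) (A `&` U) = U.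

(* Halfspaces are not required to be closed, so a halfspace defining the facet
   F is any valid halfspace lying between an open halfspace and its closure
   whose bounding hyperplane cuts F out of conv P. *)
Definition defines_facet U P F H : Prop :=
  valid_halfspace U H P /\
  exists a b, [/\ a != 0, lower_open a b `<=` H, H `<=` lower_closed a b
                & F = conv_hull P `&` hyperplane a b].

End Geometry.

Section BranchAndCut.
Context {R : realType} {n : nat}.
Local Notation V := 'cV[R]_n.
Local Notation system := (seq (set V)).
Local Notation certificate := (seq bool).

(* Only the second labels are stored: the first labels are determined by that
   of the root. [Cut G c t] stands for a node labelled with the halfspace G,
   its left child (a cutting plane certifier labelled with c) and its right
   child t. *)
Inductive bctree : Type :=
| Leaf of option certificate
| Branch (p : nat) (D : p.-tuple (set V)) (children : 'I_p -> bctree)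
| Cut (G : set V) (c : certificate) (right : bctree).

Fixpoint bc_size (t : bctree) : nat :=
  match t with
  | Leaf _ => 1
  | Branch p _ ch => (\sum_(i < p) bc_size (ch i)).+1
  | Cut _ c r => (bc_size r + size c).+2
  end.

Definition bigI (L : system) : set V := \big[setI/setT]_(K <- L) K.

Definition restrictions (U : set V) (L : system) : system :=
  [seq K `&` U | K <- L].

Definition in_families (U : set V) (S : system) : Prop :=
  forall i, (i < size S)%N -> in_family U (nth set0 S i).

(* The intersection is relative to U, so that the empty system has
   intersection U. *)
Definition infeasible (U : set V) (S : system) : Prop := U `&` bigI S = set0.

(* [accepts S c]: the checking algorithm accepts c for the system S. *)
Definition certificate_checker (U : set V)
    (accepts : system -> certificate -> bool) : Prop :=
  forall S, in_families U S -> (infeasible U S <-> exists c, accepts S c).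

(* A certificate for a system remains one when a further set is inserted. *)
Definition checker_monotone (U : set V)
    (accepts : system -> certificate -> bool) : Prop :=
  forall S1 K S2 c, in_families U (S1 ++ K :: S2) ->
    accepts (S1 ++ S2) c -> accepts (S1 ++ K :: S2) c.

Section Complexity.
Variables (U : set V) (accepts : system -> certificate -> bool).
Variables (disj : set system) (cuts : set (set V)).

Fixpoint bc_valid (L : system) (t : bctree) : Prop :=
  match t with
  | Leaf o => if o is Some c then accepts (restrictions U L) c : Prop else True
  | Branch p D ch =>
      [/\ disj D, valid_disjunction U D
        & forall i, bc_valid (rcons L (tnth D i)) (ch i)]
  | Cut G c r =>
      [/\ cuts G, valid_halfspace U G (U `&` bigI L),
          accepts (rcons (restrictions U L) (U `\` G)) c
        & bc_valid (rcons L G) r]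
  end.

(* Every leaf other than the cutting plane certifiers. *)
Fixpoint bc_leaves_in (H : set V) (L : system) (t : bctree) : Prop :=
  match t with
  | Leaf _ => bigI L `<=` H
  | Branch p D ch => forall i, bc_leaves_in H (rcons L (tnth D i)) (ch i)
  | Cut G _ r => bc_leaves_in H (rcons L G) r
  end.

Definition proves (L : system) (H : set V) (t : bctree) : Prop :=
  bc_valid L t /\ bc_leaves_in H L t.

(* Complexities are extended reals: the infimum of the empty set is +oo. *)
Definition halfspace_complexity (L : system) (H : set V) : \bar R :=
  ereal_inf [set ((bc_size t)%:R)%:E | t in proves L H].

Definition validity_complexity (L : system) (P : set V) : \bar R :=
  ereal_sup [set halfspace_complexity L H | H in [set H | valid_halfspace U H P]].

Definition one_facet_complexity (L : system) (P F : set V) : \bar R :=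
  ereal_inf [set halfspace_complexity L H | H in defines_facet U P F].

(* 0 is included because conv P = R^n has no facet and ereal_sup set0 = -oo. *)
Definition facet_complexity (L : system) (P : set V) : \bar R :=
  ereal_sup (0%E |` [set one_facet_complexity L P F | F in facet (conv_hull P)]).

End Complexity.
End BranchAndCut.

(* Main.v *)
(* The lower bound holds because each facet is defined by a closed valid
   halfspace.

   For the upper bound, let [H] be a valid halfspace. The polyhedron [conv P] is
   the intersection of the halfspaces [H_i] that define its facets with least
   complexity, and it is disjoint from the complement of [H]. By Helly's theorem
   at most [n] of the [H_i], say [H_1, ..., H_k], already intersect inside [H].
   Branch on [H_1] and its complement, then, in the child of [H_1], on [H_2] and
   its complement, and so on; below the complement of [H_i] paste the tree that
   proves [H_i], whose leaves become empty. This costs at most one node more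
   than that tree for each [i]. *)

Require Import Defs.
From mathcomp Require Import all_boot all_order all_algebra.
From mathcomp Require Import boolp classical_sets reals constructive_ereal ereal.
From mathcomp Require Import convex interval_inference zify ring lra.

Set Implicit Arguments.
Unset Strict Implicit.
Unset Printing Implicit Defensive.

Import Order.TTheory GRing.Theory Num.Theory.

Local Open Scope classical_set_scope.
Local Open Scope ring_scope.

(** * Convex sets, halfspaces and Helly's theorem *)

Section Convexity.
Context {R : realType} {n : nat}.
Local Notation V := 'cV[R]_n.
Implicit Types (A B : set V) (a : 'rV[R]_n).

(** Replaces the interval-typed weights of [convex_set] by reals with explicit bounds, on which
    [lra] and [nra] can work. *)
Lemma convexP A : convex A <->
  forall x y (t : R), 0 <= t <= 1 -> A x -> A y -> A (t *: x + (1 - t) *: y).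
Proof.
split=> [cA x y t t01 Ax Ay|cA x y l /set_mem Ax /set_mem Ay].
  have [u ->] : exists u : {i01 R}, t = u%:num.
    have ti : Itv.spec (@Itv.num_sem R) (Itv.Real `[0%Z, 1%Z]) t.
      by apply/andP; split; [rewrite num_real|rewrite in_itv].
    by exists (Itv.Def ti).
  by apply: set_mem; apply: cA; apply: mem_set.
by apply: mem_set; apply: (cA x y l%:num) => //; rewrite ge0/= le1.
Qed.

Lemma convexT : convex [set: V].
Proof. by apply/convexP. Qed.

Lemma convex0 : convex (set0 : set V).
Proof. by apply/convexP. Qed.

Lemma halfspaceT : halfspace [set: V].
Proof. by split; [exact: convexT|rewrite setCT; exact: convex0]. Qed.

Lemma dotD a (x y : V) : (a *m (x + y)) 0 0 = (a *m x) 0 0 + (a *m y) 0 0.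
Proof. by rewrite mulmxDr mxE. Qed.

Lemma dotN a (x : V) : (a *m (- x)) 0 0 = - (a *m x) 0 0.
Proof. by rewrite mulmxN mxE. Qed.

Lemma dotB a (x y : V) : (a *m (x - y)) 0 0 = (a *m x) 0 0 - (a *m y) 0 0.
Proof. by rewrite dotD dotN. Qed.

Lemma dotZ a (t : R) (x : V) : (a *m (t *: x)) 0 0 = t * (a *m x) 0 0.
Proof. by rewrite -scalemxAr mxE. Qed.

Lemma dot_eq0 a : (forall x : V, (a *m x) 0 0 = 0) -> a = 0.
Proof.
move=> a0; apply/rowP => j; have := a0 (delta_mx j 0).
by rewrite -colE !mxE.
Qed.

Lemma halfspace_lower_closed a (b : R) : halfspace (lower_closed a b).
Proof.
have setCE : ~` lower_closed a b = [set x | b < (a *m x) 0 0].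
  by apply/seteqP; split=> x; rewrite /lower_closed /setC/= ltNge => /negP.
rewrite /halfspace setCE; split; apply/convexP => x y t /andP[t0 t1];
  rewrite /lower_closed/= dotD !dotZ => xb yb; first nra.
(* The strict inequality at [x] survives only a positive weight; at weight 0 the point is [y]. *)
have [->|t_neq0] := eqVneq t 0; first lra.
have t_gt0 : 0 < t by rewrite lt_neqAle eq_sym t_neq0.
nra.
Qed.

Lemma convex_conv_hull A : convex (conv_hull A).
Proof.
apply/convexP => x y t t01 Ax Ay B [cB AB].
by move: (cB) => /convexP; apply=> //; [exact: Ax|exact: Ay].
Qed.

Lemma conv_hull_sub A B : convex B -> A `<=` B -> conv_hull A `<=` B.
Proof. exact: smallest_sub. Qed.

Lemma sub_conv_hull A : A `<=` conv_hull A.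
Proof. exact: sub_smallest. Qed.

(** The pair of total weight and weighted sum is either (0, 0) or has positive weight and barycenter
    in [A], a property stable under addition. Weights are not normalized, so that coefficients of an
    affine dependency can be used directly. *)
Lemma convex_sum A (I : finType) (p : pred I) (l : I -> R) (x : I -> V) :
    convex A -> (forall i, p i -> 0 <= l i) -> (forall i, p i -> A (x i)) ->
    0 < \sum_(i | p i) l i ->
  A ((\sum_(i | p i) l i)^-1 *: \sum_(i | p i) l i *: x i).
Proof.
move=> /convexP cA l0 Ax s0.
pose C (s : R) (v : V) := (s = 0 /\ v = 0) \/ (0 < s /\ A (s^-1 *: v)).
suff: C (\sum_(i | p i) l i) (\sum_(i | p i) l i *: x i).
  by move=> [[s00 _]|[]//]; rewrite s00 ltxx in s0.
apply: (big_ind2 C) => [|s v s' v'|i pi].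
- by left.
- case=> [[-> ->]|[sp Av]]; first by rewrite !add0r.
  case=> [[-> ->]|[sp' Av']]; first by right; rewrite !addr0.
  right; split; first exact: addr_gt0.
  have -> : (s + s')^-1 *: (v + v') =
      (s / (s + s')) *: (s^-1 *: v) + (1 - s / (s + s')) *: (s'^-1 *: v').
    by rewrite scalerDr !scalerA; congr (_ *: _ + _ *: _); field; lra.
  apply: cA => //; apply/andP; split; first by apply: divr_ge0; lra.
  by rewrite ler_pdivrMr; lra.
- have := l0 i pi; rewrite le_eqVlt => /orP[/eqP<-|li].
    by left; rewrite scale0r.
  by right; split=> //; rewrite scalerA mulVf ?gt_eqF// scale1r; exact: Ax.
Qed.

(* Radon: an affine dependency of the points [p k] splits by the signs of its
   coefficients into two convex combinations with the same value; that value
   lies in every [C j], because [p j] occurs in only one of the two. *)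
Lemma helly_step (m : nat) (C : 'I_m -> set V) :
    (forall k, convex (C k)) -> (n.+1 < m)%N ->
    (forall k, exists p, forall j, j != k -> C j p) ->
  exists q, forall j, C j q.
Proof.
move=> cC nm /choice[p Cp].
(* A left kernel vector is an affine dependency: the column of ones makes its coefficients sum to
   0. *)
pose A : 'M[R]_(m, n + 1) := \matrix_i row_mx (p i)^T 1.
have: kermx A != 0.
  rewrite kermx_eq0 /row_free neq_ltn (leq_ltn_trans (rank_leq_col A))//.
  by rewrite addn1.
move=> /rowV0Pn[l /sub_kermxP lA l_neq0].
have lE : l *m A = \sum_i l 0 i *: row_mx (p i)^T 1.
  by rewrite mulmx_sum_row; apply: eq_bigr => i _; rewrite rowK.
have sum_l : \sum_i l 0 i = 0.
  have := congr1 (fun B : 'M[R]_(1, n + 1) => (rsubmx B : 'M[R]_1) 0 0) lA.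
  rewrite lE linear_sum summxE linear0 [RHS]mxE => /(eq_trans _); apply.
  by apply: eq_bigr => i _; rewrite linearZ/= row_mxKr !mxE mulr1.
have sum_lp : \sum_i l 0 i *: p i = 0.
  have := congr1 (fun B : 'M[R]_(1, n + 1) => (lsubmx B)^T) lA; rewrite lE.
  rewrite !linear_sum/= linear0 trmx0 => /(eq_trans _); apply.
  by apply: eq_bigr => i _; rewrite !linearZ/= row_mxKl trmxK.
pose s := \sum_(i | 0 < l 0 i) l 0 i.
have sE : s = \sum_(i | ~~ (0 < l 0 i)) - l 0 i.
  apply/eqP; rewrite sumrN -subr_eq0 opprK; apply/eqP.
  by rewrite -[RHS]sum_l [RHS](bigID (fun i => 0 < l 0 i)).
have s_ge0 : 0 <= s by apply: sumr_ge0 => i /ltW.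
have s_gt0 : 0 < s.
  rewrite lt_neqAle s_ge0 andbT eq_sym; apply: contra l_neq0 => /eqP s0.
  apply/eqP/rowP => k; rewrite [RHS]mxE.
  have [lk|] := boolP (0 < l 0 k).
    by move/psumr_eq0P: s0 => ->// i /ltW.
  move=> lk; move: sE; rewrite s0 => /esym/psumr_eq0P.
  move=> /(_ _ k lk)/eqP; rewrite oppr_eq0 => h; apply/eqP; apply: h => i.
  by rewrite -leNgt oppr_ge0.
pose v := \sum_(i | 0 < l 0 i) l 0 i *: p i.
have vE : v = \sum_(i | ~~ (0 < l 0 i)) - l 0 i *: p i.
  under eq_bigr do rewrite scaleNr.
  apply/eqP; rewrite sumrN -subr_eq0 opprK; apply/eqP.
  by rewrite -[RHS]sum_lp [RHS](bigID (fun i => 0 < l 0 i)).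
exists (s^-1 *: v) => j; have [lj|lj] := boolP (0 < l 0 j).
  rewrite vE sE; apply: convex_sum => //; last by rewrite -sE.
    by move=> i; rewrite -leNgt oppr_ge0.
  move=> i li; apply: Cp; apply: contraNneq li => <-; exact: lj.
apply: convex_sum => // [i /ltW//|i li].
by apply: Cp; apply: contraNneq lj => ->.
Qed.

(** Take an inclusion-minimal subfamily with empty intersection. Dropping any one member leaves a
    common point, so with more than [n.+1] members [helly_step] would give a point of all of
    them. *)
Lemma helly (I : finType) (C : I -> set V) :
    (forall i, convex (C i)) -> \bigcap_i C i = set0 ->
  exists2 S : {set I}, (#|S| <= n.+1)%N & \bigcap_(i in [set` S]) C i = set0.
Proof.
move=> cC C0; pose p (S : {set I}) := `[< \bigcap_(i in [set` S]) C i = set0 >].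
have pT : p [set: I]%SET.
  apply/asboolP; rewrite -C0; congr bigcap.
  by apply/seteqP; split=> // i _ /=; rewrite inE.
have [S /minsetP[/asboolP S0 Smin] _] := minset_exists pT; exists S => //.
rewrite leqNgt; apply/negP => nS.
have [k||q Cq] := @helly_step #|S| (fun k => C (enum_val k)) _ nS.
- exact: cC.
- move=> k; have /eqP/set0P[q Cq] :
      \bigcap_(i in [set` S :\ enum_val k]) C i <> set0.
    move=> /asboolP/Smin/(_ (subsetDl _ _)) SD.
    have : enum_val k \in S :\ enum_val k by rewrite SD; exact: enum_valP.
    by rewrite setD11.
  exists q => j jk; apply: Cq => /=.
  by rewrite !inE (enum_valP j) andbT; apply: contraNneq jk => /enum_val_inj->.
- have : (\bigcap_(i in [set` S]) C i) q.
    by move=> i /= iS; rewrite -(enum_rankK_in iS iS); exact: Cq.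
  by rewrite S0.
Qed.

End Convexity.

(** * Transferring and pasting branch-and-cut trees *)

Section BranchAndCut.
Context {R : realType} {n : nat}.
Local Notation V := 'cV[R]_n.
Implicit Types (A H X : set V) (L s : seq (set V)) (T : @bctree R n).

Lemma bigI_rcons L X : bigI (rcons L X) = bigI L `&` X.
Proof. by rewrite /bigI -cats1 big_cat big_seq1. Qed.

Lemma bigI_cons L X : bigI (X :: L) = X `&` bigI L.
Proof. exact: big_cons. Qed.

Lemma bigI_insert_sub L1 X L2 : bigI (L1 ++ X :: L2) `<=` bigI (L1 ++ L2).
Proof. by rewrite /bigI !big_cat big_cons/= => x [? []]. Qed.

Lemma halfspace_disjunction (U : set V) H :
  halfspace H -> valid_disjunction U [:: H; ~` H].
Proof.
case=> cH cHC; split; first by case=> [|[|]].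
rewrite !big_cons big_nil setU0 -setIUl setUCr setTI //.
Qed.

Variables (U : set V) (accepts : seq (set V) -> seq bool -> bool).
Variables (disj : set (seq (set V))) (cuts : set (set V)).

Local Notation bc_valid := (bc_valid U accepts disj cuts).
Local Notation proves := (proves U accepts disj cuts).

Lemma in_family_restriction X : convex X -> in_family U (X `&` U).
Proof. by exists X. Qed.

Lemma in_families_restrictions L :
  (forall A, A \in L -> convex A) -> in_families U (restrictions U L).
Proof.
move=> cL i; rewrite size_map => iL; rewrite (nth_map set0)//.
by apply: in_family_restriction; apply: cL; exact: mem_nth.
Qed.

Lemma in_families_cut L X : (forall A, A \in L -> convex A) -> halfspace X ->
  in_families U (rcons (restrictions U L) (U `\` X)).
Proof.
move=> cL [_ cX]; have -> : U `\` X = ~` X `&` U by rewrite setDE setIC.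
rewrite -map_rcons; apply: in_families_restrictions => A.
by rewrite mem_rcons inE => /predU1P[->//|]; exact: cL.
Qed.

(** A further set shrinks the intersections, so halfspaces stay valid; certificates survive by
    monotonicity of the checker. The set is inserted in the middle because deeper nodes append
    theirs at the end. *)
Lemma bc_valid_insert T L1 X L2 : checker_monotone U accepts ->
    (forall A, A \in L1 ++ X :: L2 -> convex A) ->
  bc_valid (L1 ++ L2) T -> bc_valid (L1 ++ X :: L2) T.
Proof.
move=> accepts_mono.
elim: T L2 => [[c|]|p D ch IH|G c r IH] L2 cL //=.
- rewrite /restrictions !map_cat => ac; apply: accepts_mono => //.
  by have := in_families_restrictions cL; rewrite /restrictions map_cat.
- case=> Dd vD vch; split=> // i; rewrite rcons_cat rcons_cons.
  apply: IH; last by rewrite -rcons_cat; exact: vch.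
  move=> A; rewrite -rcons_cons -rcons_cat mem_rcons inE => /predU1P[->|/cL//].
  rewrite (tnth_nth set0); case: vD => + _; apply.
  by rewrite size_tuple.
- case=> Gc [hG LG] ac vr; split=> //.
  + split=> //; apply: subset_trans LG; apply: setIS.
    exact: bigI_insert_sub.
  + have := in_families_cut cL hG.
    rewrite /restrictions map_cat/= rcons_cat/= => cL'.
    apply: accepts_mono => //.
    by rewrite -rcons_cat -map_cat.
  + rewrite rcons_cat rcons_cons; apply: IH; last by rewrite -rcons_cat.
    move=> A; rewrite -rcons_cons -rcons_cat mem_rcons inE.
    by move=> /predU1P[->|/cL//]; case: hG.
Qed.

Lemma bc_leaves_in_sub T L L' H H' : bc_leaves_in H L T ->
  bigI L' `<=` bigI L -> bigI L' `&` H `<=` H' -> bc_leaves_in H' L' T.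
Proof.
elim: T L L' => [o|p D ch IH|G c r IH] L L' /=.
- by move=> LH L'L L'H x L'x; apply: L'H; split=> //; apply/LH/L'L.
- move=> lch L'L L'H i; apply: (IH i _ _ (lch i)); rewrite !bigI_rcons.
    exact: setSI.
  by move=> x [[L'x _] Hx]; exact: L'H.
- move=> lr L'L L'H; apply: (IH _ _ lr); rewrite !bigI_rcons.
    exact: setSI.
  by move=> x [[L'x _] Hx]; exact: L'H.
Qed.

(** Serves twice: with [H' = H], to move a tree below a branching halfspace, and with [X] the
    complement of [H], where the leaves are empty and [H'] is arbitrary. *)
Lemma proves_rcons T L X H H' : checker_monotone U accepts ->
    (forall A, A \in rcons L X -> convex A) -> proves L H T ->
  bigI L `&` X `&` H `<=` H' -> proves (rcons L X) H' T.
Proof.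
move=> accepts_mono cL [vT lT] LXH; split.
  rewrite -cats1; apply: bc_valid_insert => //; first by rewrite cats1.
  by rewrite cats0.
by apply: bc_leaves_in_sub lT _ _; rewrite bigI_rcons.
Qed.

(* Branch on [A] and its complement: under the complement of [A], the tree
   proving [A] only has empty leaves. The tree of the last halfspace is used
   without branching, which saves the final leaf. *)
Lemma proves_combine (N : nat) s A L H : checker_monotone U accepts ->
    (forall X, halfspace X -> disj [:: X; ~` X]) ->
    (forall X, X \in L -> convex X) ->
    (forall X, X \in A :: s ->
      halfspace X /\ exists2 T, proves L X T & (bc_size T <= N)%N) ->
    bigI L `&` bigI (A :: s) `<=` H ->
  exists2 T, proves L H T & (bc_size T <= N + size s * N.+1)%N.
Proof.
move=> accepts_mono disj_simple.
elim: s A L => [|B s IH] A L cL sP LH.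
  have [hA [T [vT lT] TN]] := sP A (mem_head _ _).
  exists T; last by rewrite mul0n addn0.
  split=> //; apply: bc_leaves_in_sub lT _ _ => // x [Lx Ax]; apply: LH.
  by rewrite bigI_cons /bigI big_nil setIT.
have [hA [T pT TN]] := sP A (mem_head _ _).
have cLA X : X \in rcons L A -> convex X.
  by rewrite mem_rcons inE => /predU1P[->|/cL//]; case: hA.
have cLAC X : X \in rcons L (~` A) -> convex X.
  by rewrite mem_rcons inE => /predU1P[->|/cL//]; case: hA.
have [|||T' [vT' lT'] TN'] := IH B (rcons L A) => //.
- move=> X XBs; have [|hX [TX pX XN]] := sP X.
    by rewrite inE XBs orbT.
  split=> //; exists TX => //; exact: proves_rcons pX _.
- apply: subset_trans LH; rewrite bigI_rcons (bigI_cons (B :: s)).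
  by rewrite setIA.
have [vT lT] : proves (rcons L (~` A)) H T.
  by apply: proves_rcons pT _ => // x [[]].
exists (@Branch R n 2 [tuple A; ~` A] (fun i => if i == 0 then T' else T)).
  split=> /=.
    split; [exact: disj_simple|exact: halfspace_disjunction|].
    by move=> i; case: (unliftP 0 i) => [j ->|->]//=; rewrite ord1.
  by move=> i; case: (unliftP 0 i) => [j ->|->]//=; rewrite ord1.
(* The root and the tree under the complement of [A] add at most [N.+1] to the size. *)
rewrite /= big_ord_recl big_ord1 /= mulSn.
by rewrite (leq_ltn_trans (leq_add TN' TN))//; lia.
Qed.

End BranchAndCut.

(** * Facets of a full-dimensional polyhedron *)

Section Facets.
Context {R : realType} {n : nat}.
Local Notation V := 'cV[R]_n.
Implicit Types (Q F P H : set V) (a : 'rV[R]_n) (b : R).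

(** One step length that respects finitely many positive slacks [g]. The sum of the ratios
    [|f j| / g j] bounds each of them, even for empty [J], and adding 1 makes it invertible. *)
Lemma exists_small_scale (J : finType) (f g : J -> R) :
  (forall j, 0 < g j) -> exists2 e, 0 < e & forall j, e * f j <= g j.
Proof.
move=> g0; pose s := \sum_j `|f j| / g j.
have s_ge0 : 0 <= s by apply: sumr_ge0 => j _; rewrite divr_ge0// ltW.
exists (1 + s)^-1; first by rewrite invr_gt0; lra.
move=> j; rewrite mulrC ler_pdivrMr; last lra.
have : `|f j| / g j <= s.
  rewrite /s (bigD1 j)//= lerDl; apply: sumr_ge0 => i _.
  by rewrite divr_ge0// ltW.
rewrite ler_pdivrMr// => fs.
by have := ler_norm (f j); have := g0 j; nra.
Qed.

(** Keep a minimal set of rows that still describes [Q]; by minimality, dropping row [k] admits a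
    point that violates row [k] alone. *)
Lemma polyhedron_irredundant Q : polyhedron Q ->
  exists (I : finType) (a : I -> 'rV[R]_n) (b : I -> R),
    Q = \bigcap_i lower_closed (a i) (b i) /\
    forall k, exists2 y : V, b k < (a k *m y) 0 0 &
      forall j, j != k -> (a j *m y) 0 0 <= b j.
Proof.
move=> [m [M [c QE]]].
pose C i : set V := lower_closed (row i M) (c i 0).
pose p (S : {set 'I_m}) := `[< \bigcap_(i in [set` S]) C i `<=` Q >].
have pT : p [set: 'I_m]%SET.
  apply/asboolP => x Cx; rewrite QE /= => i.
  have := Cx i; rewrite /C /lower_closed/= -row_mul mxE; apply.
  by rewrite inE.
have [S /minsetP[/asboolP SQ Smin] _] := minset_exists pT.
have QS : Q `<=` \bigcap_(i in [set` S]) C i.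
  move=> x; rewrite QE => Qx i _.
  by rewrite /C /lower_closed/= -row_mul mxE; exact: Qx.
exists {i | i \in S}, (fun i => row (val i) M), (fun i => c (val i) 0); split.
  apply/seteqP; split=> [x Qx i _|x Cx]; first exact: (QS x Qx _ (valP i)).
  by apply: SQ => i iS; exact: (Cx (exist _ i iS)).
move=> k; have : ~ (\bigcap_(i in [set` S :\ val k]) C i `<=` Q).
  move=> /asboolP/Smin/(_ (subsetDl _ _)) SD.
  have : val k \in S :\ val k by rewrite SD; exact: valP.
  by rewrite setD11.
move=> /existsNP[y] /not_implyP[Cy Qy].
have Cyj (j : {i | i \in S}) : j != k -> (row (val j) M *m y) 0 0 <= c (val j) 0.
  by move=> jk; apply: Cy; rewrite /= !inE (valP j) andbT.
exists y => //; rewrite ltNge; apply/negP => Cyk; apply: Qy; apply: SQ => i iS.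
have [ik|/Cyj//] := boolP (exist (fun j => j \in S) i iS == k).
by move: Cyk; rewrite -(eqP ik).
Qed.

(** Take the barycenter of [n.+1] affinely independent points. Equality there would force equality
    at each of them, so [a] would vanish on [n] independent differences and be 0. *)
Lemma full_dimensional_interior Q : convex Q -> full_dimensional Q ->
  exists2 z, Q z &
    forall a b, a != 0 -> Q `<=` lower_closed a b -> (a *m z) 0 0 < b.
Proof.
move=> cQ [[x [xfree Qx]] _]; pose N : R := \sum_(i < n.+1) 1.
have N_gt0 : 0 < N by rewrite /N sumr_const card_ord ltr0n.
exists (N^-1 *: \sum_(i < n.+1) 1 *: x i) => [|a b a_neq0 Qab].
  by apply: convex_sum.
rewrite dotZ mulrC ltr_pdivrMr// mulr_sumr mulmx_sumr summxE.
rewrite lt_neqAle; apply/andP; split; last first.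
  by apply: ler_sum => i _; rewrite scale1r mulr1; exact: Qab.
apply: contra a_neq0; rewrite eq_sym -subr_eq0 -sumrB => /eqP/psumr_eq0P ax.
have {}ax i : (a *m x i) 0 0 = b.
  apply/esym/eqP; rewrite -subr_eq0 -[b]mulr1 -{1}[x i]scale1r ax// => j _.
  by rewrite mulr1 scale1r subr_ge0; exact: Qab.
rewrite -(inj_eq (@trmx_inj _ _ _)) trmx0; apply/eqP.
move: xfree; rewrite /affinely_independent row_free_unit.
set X := (X in X \in unitmx) => Xu.
rewrite -(mulKmx Xu a^T); suff -> : X *m a^T = 0 by rewrite mulmx0.
apply: trmx_inj; rewrite trmx_mul trmxK trmx0; apply/rowP => i.
rewrite [RHS]mxE -[RHS](subrr b) -{1}(ax (lift ord0 i)) -(ax ord0) -dotB.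
by rewrite !mxE; apply: eq_bigr => j _; rewrite !mxE.
Qed.

Lemma rank_kermx_row a : a != 0 -> (\rank (kermx a^T)).+1 = n.
Proof.
move=> a_neq0; have n_gt0 : (0 < n)%N.
  by have := rank_leq_col a; rewrite rank_rV a_neq0.
by rewrite mxrank_ker mxrank_tr rank_rV a_neq0 subn1 prednK.
Qed.

Lemma dot_row_kermx (p : nat) (B : 'M[R]_(p, n)) a (i : 'I_p) :
  B *m a^T = 0 -> (a *m (row i B)^T) 0 0 = 0.
Proof.
by rewrite -[a in X in _ -> X]trmxK -trmx_mul -row_mul => ->; rewrite !mxE.
Qed.

(** Differences of points of [F] lie in the kernel of [a], which bounds the dimension; [w] and its
    shifts along a scaled basis of that kernel attain the bound. Writing the dimension as a rank
    lets [row_base] index the basis without casts. *)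
Lemma has_dim_hyperplane_face a b F w : a != 0 ->
    F `<=` hyperplane a b ->
    (forall (J : finType) (v : J -> V), (forall j, (a *m v j) 0 0 = 0) ->
      exists2 e : R, 0 < e & forall j, F (w + e *: v j)) ->
  has_dim F (\rank (kermx a^T)).
Proof.
move=> a_neq0 Fab Fw; pose B := row_base (kermx a^T).
have Ba : B *m a^T = 0 by apply/sub_kermxP; rewrite eq_row_base.
split; last first.
  move=> k x; rewrite /affinely_independent; set X := \matrix__ _ => Xfree Fx.
  move: (Xfree) => /eqP{1}<-; apply: mxrankS; apply/sub_kermxP.
  apply: trmx_inj; rewrite trmx_mul trmxK trmx0; apply/rowP => i.
  rewrite [RHS]mxE -[RHS](subrr b) -{1}(Fab _ (Fx (lift ord0 i))).
  rewrite -(Fab _ (Fx ord0)) -dotB.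
  by rewrite !mxE; apply: eq_bigr => j _; rewrite !mxE.
pose v (j : option 'I_(\rank (kermx a^T))) : V :=
  if j is Some i then (row i B)^T else 0.
have [|e e_gt0 Fe] := Fw _ v.
  by move=> [i|] /=; [exact: dot_row_kermx|rewrite mulmx0 mxE].
exists (fun i => w + e *: v (unlift ord0 i)); split=> //.
rewrite /affinely_independent.
have -> : \matrix_i (w + e *: v (unlift ord0 (lift ord0 i)) -
    (w + e *: v (unlift ord0 ord0)))^T = e *: B.
  apply/row_matrixP => i; rewrite rowK liftK unlift_none/= scaler0 addr0.
  by rewrite addrC addKr linearZ/= trmxK linearZ.
rewrite /row_free mxrank_scale_nz ?(gt_eqF e_gt0)//.
exact: row_base_free.
Qed.

(* The functional [a'] vanishes on the kernel of [a], because [w + e v] stays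
   in the face for each [v] in that kernel; hence [a' = mu a], and comparing
   the values at the interior point [z] gives [0 < mu]. *)
Lemma facet_halfspace_sub Q F a b a' b' z w : a' != 0 ->
    Q z -> (a *m z) 0 0 < b -> F w -> F `<=` hyperplane a b ->
    (forall v, (a *m v) 0 0 = 0 -> exists2 e : R, 0 < e & F (w + e *: v)) ->
    Q `<=` lower_closed a' b' -> F = Q `&` hyperplane a' b' ->
  lower_closed a' b' `<=` lower_closed a b.
Proof.
move=> a'_neq0 Qz az Fw Fab Fker Qab' FE.
have aw : (a *m w) 0 0 = b by exact: Fab.
have Fab' x : F x -> (a' *m x) 0 0 = b' by rewrite FE => -[].
have a'w := Fab' _ Fw.
have ker (v : V) : (a *m v) 0 0 = 0 -> (a' *m v) 0 0 = 0.
  move=> /Fker[e e_gt0 /Fab']; rewrite dotD dotZ a'w => h.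
  have /eqP : e * (a' *m v) 0 0 = 0 by lra.
  by rewrite mulf_eq0 gt_eqF//= => /eqP.
have [d dE] : exists d, d = z - w by exists (z - w).
have ad : (a *m d) 0 0 < 0 by rewrite dE dotB aw; lra.
pose mu := (a' *m d) 0 0 / (a *m d) 0 0.
have a'E (v : V) : (a' *m v) 0 0 = mu * (a *m v) 0 0.
  have := ker (v - ((a *m v) 0 0 / (a *m d) 0 0) *: d).
  rewrite !dotB !dotZ divfK ?lt_eqF// subrr => /(_ erefl)/eqP.
  by rewrite subr_eq0 => /eqP ->; rewrite /mu; ring.
have mu_ge0 : 0 <= mu.
  have : (a' *m z) 0 0 <= b' by exact: Qab'.
  by have := a'E d; rewrite {1}dE dotB a'w; nra.
have mu_gt0 : 0 < mu.
  rewrite lt_neqAle mu_ge0 andbT; apply: contra a'_neq0 => /eqP mu0.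
  by apply/eqP/dot_eq0 => x; rewrite a'E -mu0 mul0r.
move=> x; rewrite /lower_closed/= -a'w !a'E aw.
by rewrite ler_pM2l.
Qed.

(** Each irredundant inequality is tight alone at some point [w i], so it cuts out a facet, and by
    [facet_halfspace_sub] any other inequality for that facet implies it. *)
Lemma polyhedron_facets Q : polyhedron Q -> full_dimensional Q -> convex Q ->
  exists (I : finType) (F : I -> set V), (forall i, facet Q (F i)) /\
    forall H : I -> set V,
      (forall i, exists a b, [/\ a != 0, Q `<=` lower_closed a b,
        H i `<=` lower_closed a b & F i = Q `&` hyperplane a b]) ->
      \bigcap_i H i `<=` Q.
Proof.
move=> pQ dQ cQ; have [z Qz zQ] := full_dimensional_interior cQ dQ.
have [I [a [b [QE irr]]]] := polyhedron_irredundant pQ.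
have Qab i : Q `<=` lower_closed (a i) (b i) by rewrite QE => x; exact.
have a_neq0 i : a i != 0.
  have [y yi _] := irr i; apply: contraTneq yi => ai0.
  by have := Qab i z Qz; rewrite /lower_closed/= ai0 !mul0mx !mxE -leNgt.
have az i : (a i *m z) 0 0 < b i by exact: zQ.
have /choice[w wP] : forall i, exists w : V, (a i *m w) 0 0 = b i /\
    forall j, j != i -> (a j *m w) 0 0 < b j.
  move=> i; have [y yi yj] := irr i; have azi := az i.
  (* The segment from the interior point [z] to [y] crosses hyperplane [i] at parameter [t]; the
     other inequalities stay strict there because [z] keeps a positive weight. *)
  pose t := (b i - (a i *m z) 0 0) / ((a i *m y) 0 0 - (a i *m z) 0 0).
  have ayz : 0 < (a i *m y) 0 0 - (a i *m z) 0 0 by lra.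
  exists (z + t *: (y - z)).
  have t_gt0 : 0 < t by apply: divr_gt0; lra.
  have t_lt1 : t < 1 by rewrite /t ltr_pdivrMr; lra.
  split=> [|j /yj yjb]; rewrite dotD dotZ dotB.
    by rewrite /t divfK ?gt_eqF// addrC subrK.
  by have azj := az j; clearbody t; nra.
pose F i := Q `&` hyperplane (a i) (b i).
have Fw i (J : finType) (v : J -> V) : (forall j, (a i *m v j) 0 0 = 0) ->
    exists2 e : R, 0 < e & forall j, F i (w i + e *: v j).
  move=> av; have [awi awj] := wP i.
  (* Inequality [i] has no slack at [w i], but the directions leave it unchanged: a dummy slack 1
     replaces it. *)
  have [|e e_gt0 eP] := @exists_small_scale (I * J)%type
    (fun p => if p.1 == i then 0 else (a p.1 *m v p.2) 0 0)
    (fun p => if p.1 == i then 1 else b p.1 - (a p.1 *m w i) 0 0).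
    by move=> [k j] /=; case: eqVneq => // /awj; rewrite subr_gt0.
  exists e => // j; rewrite /F /hyperplane QE; split=> [k _|]/=; last first.
    by rewrite dotD dotZ av mulr0 addr0.
  rewrite /lower_closed/= dotD dotZ.
  have := eP (k, j) => /=; case: eqVneq => [->|ki]; last lra.
  by rewrite av awi mulr0 addr0.
exists I, F; split=> [i|H HP x Hx].
  split; first by exists (a i), (b i).
  exists (\rank (kermx (a i)^T)); split; first by rewrite rank_kermx_row.
  exact: has_dim_hyperplane_face (a_neq0 i) (@subIsetr _ Q _) (Fw i).
rewrite QE => i _; have [a' [b' [a'_neq0 Qa' Ha' FE]]] := HP i.
apply: (facet_halfspace_sub (w := w i) a'_neq0 Qz (az i) _ _ _ Qa' FE).
- have [|e _ /(_ tt)] := Fw i unit (fun=> 0); first by rewrite mulmx0 mxE.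
  by rewrite scaler0 addr0.
- by move=> y [].
- move=> v av; have [//|e e_gt0 /(_ tt) Fe] := Fw i unit (fun=> v).
  by exists e.
- by apply: Ha'; exact: Hx.
Qed.

End Facets.

Lemma has_dim_uniq (R : realType) (n : nat) (A : set 'cV[R]_n) (d e : nat) :
  has_dim A d -> has_dim A e -> d = e.
Proof.
move=> [[x [xfree Ax]] dmax] [[y [yfree Ay]] emax].
by apply/eqP; rewrite eqn_leq (emax _ _ xfree Ax) (dmax _ _ yfree Ay).
Qed.

(** With [a = 0], nonemptiness of [F] gives [b = 0], hence [F = Q], against the drop in
    dimension. *)
Lemma facet_normal_neq0 (R : realType) (n : nat) (Q F : set 'cV[R]_n) :
  facet Q F -> exists (a : 'rV[R]_n) (b : R),
    [/\ a != 0, Q `<=` lower_closed a b & F = Q `&` hyperplane a b].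
Proof.
move=> [[a [b [Qab FE]]] [d [Qd Fd]]]; exists a, b; split=> //.
apply/eqP => a0; have ax (x : 'cV[R]_n) : (a *m x) 0 0 = 0.
  by rewrite a0 mul0mx mxE.
have [[x [_ Fx]] _] := Fd; have b0 : b = 0.
  by have := Fx ord0; rewrite FE => -[_ <-]; rewrite ax.
suff FQ : F = Q.
  by rewrite -FQ in Qd; have /eqP := has_dim_uniq Qd Fd; rewrite eqn_leq ltnn.
rewrite FE; apply/seteqP; split=> [y []//|y Qy]; split=> //.
by rewrite /hyperplane/= ax b0.
Qed.

Lemma facet_defined (R : realType) (n : nat) (U P F : set 'cV[R]_n) :
  P `<=` U -> facet (conv_hull P) F -> exists H, defines_facet U P F H.
Proof.
move=> PU /facet_normal_neq0[a [b [a_neq0 Qab FE]]].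
exists (lower_closed a b); split.
  split; first exact: halfspace_lower_closed.
  by move=> x Px; split; [apply: Qab; exact: sub_conv_hull|exact: PU].
by exists a, b; split=> // x /ltW.
Qed.

(** * The two inequalities between the complexities *)

Section Complexities.
Context {R : realType} {n : nat}.
Variables (U : set 'cV[R]_n) (accepts : seq (set 'cV[R]_n) -> seq bool -> bool).
Variables (disj : set (seq (set 'cV[R]_n))) (cuts : set (set 'cV[R]_n)).
Implicit Types (L : seq (set 'cV[R]_n)) (P F H : set 'cV[R]_n).

Local Notation proves := (proves U accepts disj cuts).
Local Notation halfspace_complexity := (halfspace_complexity U accepts disj cuts).
Local Notation one_facet_complexity := (one_facet_complexity U accepts disj cuts).
Local Notation validity_complexity := (validity_complexity U accepts disj cuts).
Local Notation facet_complexity := (facet_complexity U accepts disj cuts).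

Lemma facet_complexity_ge0 L P : (0 <= facet_complexity L P)%E.
Proof. by apply: ereal_sup_ubound; left. Qed.

Lemma facet_le_validity_complexity L P : P `<=` U ->
  (facet_complexity L P <= validity_complexity L P)%E.
Proof.
move=> PU; apply: ge_ereal_sup => _ [->|[F /(facet_defined PU)[H HF] <-]].
  (* The adjoined value 0 is dominated because the whole space is a valid halfspace. *)
  apply: (@le_trans _ _ (halfspace_complexity L setT)).
    by apply: le_ereal_inf_tmp => _ [T _ <-]; rewrite lee_fin.
  apply: ereal_sup_ubound; exists setT => //; split; first exact: halfspaceT.
  by rewrite setTI.
apply: (@le_trans _ _ (halfspace_complexity L H)).
  by apply: ereal_inf_lbound; exists H.
by apply: ereal_sup_ubound; exists H => //; case: HF.
Qed.

(** The strict bound extracts a halfspace and a tree from the two infima without proving them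
    attained; sizes are integers, so below [N.+1] means at most [N]. *)
Lemma one_facet_complexity_le L P F (N : nat) (r : R) : r < N.+1%:R ->
    (one_facet_complexity L P F <= r%:E)%E ->
  exists2 H, defines_facet U P F H &
    exists2 T, proves L H T & (bc_size T <= N)%N.
Proof.
move=> rN Fr; have /ereal_inf_lt[_ [H HF <-]] :
  (one_facet_complexity L P F < N.+1%:R%:E)%E.
  by rewrite (le_lt_trans Fr)// lte_fin.
move=> /ereal_inf_lt[_ [T pT <-]]; rewrite lte_fin ltr_nat ltnS => TN.
by exists H => //; exists T.
Qed.

(* Helly's theorem for the [G i] and the complement of [H]: a subfamily with
   empty intersection must contain that complement, as the [G i] intersect. *)
Lemma helly_halfspaces (J : finType) (G : J -> set 'cV[R]_n) H :
    (forall i, convex (G i)) -> convex (~` H) ->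
    \bigcap_i G i !=set0 -> \bigcap_i G i `<=` H ->
  exists2 s : seq J, (size s <= n)%N & \bigcap_(i in [set` s]) G i `<=` H.
Proof.
move=> cG cHC [z Gz] GH.
pose C (o : option J) := if o is Some i then G i else ~` H.
have [||S Sn SC] := @helly _ _ _ C.
- by case.
- rewrite -subset0 => x Cx; apply: (Cx None I); apply: GH => i _.
  exact: (Cx (Some i) I).
have NS : None \in S.
  apply/negP => NS; suff : (\bigcap_(o in [set` S]) C o) z by rewrite SC.
  by case=> [i _|/= /NS//]; exact: Gz.
exists (enum [set i | Some i \in S]) => [|x Gx].
  (* [None], the complement of [H], uses up one of the [n.+1] members, which leaves [n]. *)
  rewrite -cardE -(card_imset _ (@Some_inj _)) -ltnS.
  apply: leq_trans Sn; rewrite (cardsD1 None S) NS add1n ltnS subset_leq_card//.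
  by apply/fintype.subsetP => _ /imsetP[i iS ->]; rewrite !inE in iS *.
apply: contrapT => Hx; suff : (\bigcap_(o in [set` S]) C o) x by rewrite SC.
by case=> [i /= iS|_]//=; apply: Gx; rewrite /= mem_enum inE.
Qed.

Lemma validity_le_facet_complexity L P : (0 < n)%N ->
    checker_monotone U accepts ->
    (forall H, halfspace H -> disj [:: H; ~` H]) ->
    (forall X, X \in L -> convex X) ->
    polyhedron (conv_hull P) -> full_dimensional (conv_hull P) ->
  (validity_complexity L P <= n%:R%:E * (facet_complexity L P + 1))%E.
Proof.
move=> n_gt0 accepts_mono disj_simple cL polyP dimP.
have := facet_complexity_ge0 L P; case FC : (facet_complexity L P) => [r| |]//.
  (* Rounding down loses nothing, tree sizes being integers. *)
  rewrite lee_fin => r_ge0; pose N := Num.truncn r.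
  have rN : r < N.+1%:R by exact: truncnS_gt.
  have Nr : N%:R <= r by rewrite truncn_le.
  apply: ge_ereal_sup => _ [H [hH PH] <-].
  suff [T pT TN] : exists2 T, proves L H T & (bc_size T <= n * N.+1)%N.
    apply: (@le_trans _ _ (bc_size T)%:R%:E).
      by apply: ereal_inf_lbound; exists T.
    rewrite -EFinD -EFinM lee_fin (@le_trans _ _ (n * N.+1)%:R)// ?ler_nat//.
    by rewrite natrM ler_wpM2l// -natr1 lerD2r.
  have [J [F [facF QF]]] :=
    polyhedron_facets polyP dimP (convex_conv_hull (A := P)).
  have /choice[G GP] : forall j, exists G, defines_facet U P (F j) G /\
      exists2 T, proves L G T & (bc_size T <= N)%N.
    move=> j; have [|G GF GT] := @one_facet_complexity_le L P (F j) N r rN.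
      by rewrite -FC; apply: ereal_sup_ubound; right; exists (F j).
    by exists G.
  have QG j : conv_hull P `<=` G j.
    have [[[[cG _] PG] _] _] := GP j; by apply: conv_hull_sub => // x /PG[].
  have GQ : \bigcap_j G j `<=` conv_hull P.
    apply: QF => j; have [[_ [a [b [a_neq0 _ Gab FE]]]] _] := GP j.
    by exists a, b; split=> //; exact: subset_trans (QG j) Gab.
  have [||||s sn sH] := @helly_halfspaces J G H.
  - by move=> j; have [[[[]]]] := GP j.
  - by case: hH.
  - by have [[x [_ Qx]] _] := dimP; exists (x ord0) => j _; exact: QG.
  - apply: subset_trans GQ _; apply: conv_hull_sub; first by case: hH.
    by move=> x /PH[].
  have {}sH : bigI (map G s) `<=` H by rewrite /bigI big_map -bigcap_seq.
  case: s sn sH => [_ H0|j s jsn jsH].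
    (* No halfspace is selected, so [H] is the whole space and a single leaf suffices; its size 1
       fits since [n] is positive. *)
    exists (Leaf None); last by rewrite muln_gt0 n_gt0.
    by split=> // x _; apply: H0; rewrite /bigI big_nil.
  have [||T pT TN] :=
    @proves_combine _ _ U accepts disj cuts N (map G s) (G j) L H
      accepts_mono disj_simple cL.
  - move=> X; rewrite -map_cons => /mapP[k _ ->].
    by have [[[hG _] _] GT] := GP k.
  - by move=> x [_ /jsH].
  exists T => //; rewrite (leq_trans TN)// size_map.
  apply: (@leq_trans ((size s).+1 * N.+1)); first by rewrite mulSn leq_add2r.
  by rewrite leq_mul2r jsn orbT.
(* Infinite facet complexity: the right side is [+oo] since [n] is positive. *)
by rewrite addye// gt0_muley ?leey// lte_fin ltr0n.
Qed.

End Complexities.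

Theorem theorem4p3 (R : realType) (n : nat) (n_gt0 : (0 < n)%N)
    (U : set 'cV[R]_n)
    (accepts : seq (set 'cV[R]_n) -> seq bool -> bool)
    (acceptsP : certificate_checker U accepts)
    (accepts_mono : checker_monotone U accepts)
    (disj : set (seq (set 'cV[R]_n))) (cuts : set (set 'cV[R]_n))
    (disj_simple : forall H, halfspace H -> disj [:: H; ~` H])
    (t : nat) (K K' : 'I_t -> set 'cV[R]_n) (P : set 'cV[R]_n)
    (K_family : forall i, in_family U (K i))
    (P_family : in_family U P)
    (P_system : P = \bigcap_i K i)
    (P_polyhedron : polyhedron (conv_hull P))
    (P_full_dim : full_dimensional (conv_hull P))
    (K'_relax : forall i, relaxation U (K i) (K' i)) :
  (facet_complexity U accepts disj cuts (codom K') P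
     <= validity_complexity U accepts disj cuts (codom K') P)%E /\
  (validity_complexity U accepts disj cuts (codom K') P
     <= n%:R%:E * (facet_complexity U accepts disj cuts (codom K') P + 1))%E.
Proof.
have PU : P `<=` U by case: P_family => C _ -> x [].
split; first exact: facet_le_validity_complexity.
apply: validity_le_facet_complexity => // X /codomP[i ->].
by case: (K'_relax i).
Qed.
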